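(* Let $n\in\mathbb{N}$ and $f\in C_B(\mathbb{R})\cup C_U(\mathbb{R})$. Then $$\omega(A_n(f),\theta)\le\omega(f,\theta)\qquad\text{for every }\theta>0.$$ Furthermore, if $f\in C_U(\mathbb{R})$, then $A_n(f)\in C_U(\mathbb{R})$.
   Context: Fix real parameters $q>0$, $\beta>0$, $B>1$; $\mathbb{N}=\{1,2,3,\dots\}$. For $x\in\mathbb{R}$ and any $p>0$ put $$\nu_{p,\beta}(x)=\frac{1}{1+pB^{-\beta x}},\qquad G_{p,\beta}(x)=\tfrac12\big(\nu_{p,\beta}(x+1)-\nu_{p,\beta}(x-1)\big),\qquad \Psi(x)=\tfrac12\big(G_{q,\beta}(x)+G_{1/q,\beta}(x)\big).$$ $C_B(\mathbb{R})$ is the set of continuous bounded functions $f:\mathbb{R}\to\mathbb{R}$; $C_U(\mathbb{R})$ is the set of all uniformly continuous (not necessarily bounded) functions $f:\mathbb{R}\to\mathbb{R}$. The modulus of continuity is $\omega(f,\theta)=\sup\{|f(x)-f(y)|: x,y\in\mathbb{R},\ |x-y|\le\theta\}$ for $\theta>0$. For $n\in\mathbb{N}$ the operator $A_n$ is given (for unbounded $f$ by the same formula) by $$A_n(f)(x)=\int_{-\infty}^{\infty} f\!\left(\frac{v}{n}\right)\Psi(nx-v)\,dv .$$ *)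

(* Defs.v *)
From HB Require Import structures.
From mathcomp Require Import all_boot all_order all_algebra.
From mathcomp Require Import all_classical all_reals all_analysis.
Set Implicit Arguments.
Unset Strict Implicit.
Unset Printing Implicit Defensive.
Import Order.TTheory GRing.Theory Num.Theory.
Import numFieldNormedType.Exports.
Local Open Scope classical_set_scope.
Local Open Scope ring_scope.

Definition nu (R : realType) (beta B p x : R) : R :=
  1 / (1 + p * B `^ (- beta * x)).

Definition G (R : realType) (beta B p x : R) : R :=
  1 / 2 * (nu beta B p (x + 1) - nu beta B p (x - 1)).

Definition Psi (R : realType) (q beta B x : R) : R :=
  1 / 2 * (G beta B q x + G beta B (1 / q) x).

Definition C_B (R : realType) : set (R -> R) :=
  [set f | continuous f /\ bounded_fun f].

Definition C_U (R : realType) : set (R -> R) :=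
  [set f | unif_continuous f].

Arguments C_B : clear implicits.
Arguments C_U : clear implicits.

(* The supremum is taken in the extended reals, so that it is +oo, and not a
   default value, when the oscillations of f are unbounded. *)
Definition omega (R : realType) (f : R -> R) (theta : R) : \bar R :=
  ereal_sup [set `|f z.1 - f z.2|%:E | z in
    [set z : R * R | `|z.1 - z.2| <= theta]].

(* Lebesgue integral over the whole line, as a real number; it takes a default
   value if the integral is not finite, which does not happen for f in C_B or
   C_U because Psi decays exponentially. *)
Definition A (R : realType) (q beta B : R) (n : nat) (f : R -> R) (x : R) : R :=
  \int[lebesgue_measure]_v (f (v / n%:R) * Psi q beta B (n%:R * x - v)).

(* Main.v *)
Require Import Defs.
From HB Require Import structures.
From mathcomp Require Import all_boot all_order all_algebra.
From mathcomp Require Import all_classical all_reals all_analysis measurable_realfun.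
From mathcomp Require Import ring lra.
Set Implicit Arguments.
Unset Strict Implicit.
Unset Printing Implicit Defensive.
Import Order.TTheory GRing.Theory Num.Theory.
Import numFieldNormedType.Exports.
Local Open Scope classical_set_scope.
Local Open Scope ring_scope.

(* Since nu_q(-x) = 1 - nu_(1/q)(x), the kernel Psi is even; it is nonnegative,
   bounded by a multiple of exp(-lam|x|) with lam = beta ln B, and has integral 1.
   By evenness and translation invariance,
   A_n(f)(x) = \int f(x + u/n) Psi(u) du, an average of translates of f, so that
   A_n(f) oscillates at most as much as f. A function in C_B or C_U grows at most
   linearly, which makes these integrals converge absolutely. *)

(** * Translation invariance of the integral, and an integrable exponential *)

Lemma derive1_addr (R : realType) (c : R) : ((fun x : R => x + c)^`())%classic = cst 1.
Proof.
apply/funext => x; rewrite derive1E.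
have h : is_derive x (1 : R) (fun x : R => x + c) (1 + 0) by exact: is_deriveD.
by rewrite derive_val addr0.
Qed.

Lemma ge0_integral_shift (R : realType) (c : R) (g : R -> R) :
  continuous g -> (forall x, 0 <= g x) ->
  (\int[lebesgue_measure]_x (g x)%:E =
   \int[lebesgue_measure]_x (g (x + c))%:E)%E.
Proof.
move=> cg g0.
rewrite (@increasing_ge0_integration_by_substitutionT R (fun x => x + c) g)//.
- apply: eq_integral => x _; rewrite derive1_addr.
  by rewrite /GRing.mul /= mulr1.
- by move=> x y xy; rewrite ltrD2r.
- by rewrite derive1_addr => x; exact: cst_continuous.
- by rewrite derive1_addr; exact: is_cvg_cst.
- by rewrite derive1_addr; exact: is_cvg_cst.
- apply/cvgrNyPle => M; near=> x.
  by rewrite -lerBrDr; near: x; apply: nbhs_ninfty_le; rewrite num_real.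
- apply/cvgryPge => M; near=> x.
  by rewrite -lerBlDr; near: x; apply: nbhs_pinfty_ge; rewrite num_real.
Unshelve. all: by end_near. Qed.

(** The nonnegative case applies to the positive part of [g] and, through [- g], to its negative
    part. The extended integrals therefore agree before [fine] is taken, whether or not they are
    finite. *)
Lemma Rintegral_shift (R : realType) (c : R) (g : R -> R) : continuous g ->
  \int[lebesgue_measure]_x g x = \int[lebesgue_measure]_x g (x + c).
Proof.
have pos (h : R -> R) : continuous h ->
    (\int[lebesgue_measure]_x ((EFin \o h)^\+ x) =
     \int[lebesgue_measure]_x ((EFin \o (fun y => h (y + c)%R))^\+ x))%E.
  move=> ch.
  under eq_integral do rewrite funeposE /= -EFin_max.
  under [RHS]eq_integral do rewrite funeposE /= -EFin_max.
  apply: (@ge0_integral_shift R c (h \max cst 0)) => x.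
    by apply: (@continuous_max R R) => //; [exact: ch|exact: cst_continuous].
  by rewrite /= le_max lexx orbT.
move=> cg; rewrite /Rintegral; congr fine.
rewrite integralE [RHS]integralE; congr (_ - _)%E; first exact: pos.
rewrite -2!funeposN; apply: (pos (\- g)) => x.
by apply: continuousN; exact: cg.
Qed.

(** By evenness the integral is twice that over the half-line, where the integrand is [c^-1] times
    the exponential density, which has mass 1. *)
Lemma integrable_expR_normr (R : realType) (c : R) : 0 < c ->
  lebesgue_measure.-integrable setT (EFin \o (fun x : R => expR (- (c * `|x|)))).
Proof.
move=> c0; pose h (x : R) : R := expR (- (c * `|x|)).
have ch : continuous h.
  move=> x; apply: continuous_comp; last exact: continuous_expR.
  apply: continuousN; apply: continuousM; first exact: cst_continuous.
  exact: norm_continuous.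
apply/integrableP; split.
  by apply/measurable_EFinP; exact: continuous_measurable_fun.
under eq_integral do rewrite /= ger0_norm ?expR_ge0//.
rewrite (@ge0_symfun_integralT R h)//; last 2 first.
- by move=> x; exact: expR_ge0.
- by move=> x; rewrite /h /= normrN.
apply: lte_mul_pinfty => //.
have m0 : measurable [set x : R | 0 <= x] by rewrite -set_itvcy.
apply: (@le_lt_trans _ _ (\int[lebesgue_measure]_(x in [set x : R | (0 <= x)%R])
    (c^-1%:E * (exponential_pdf c x)%:E)))%E.
  apply: ge0_le_integral => //.
  - by move=> x _; rewrite lee_fin expR_ge0.
  - apply/measurable_EFinP; apply: measurable_funTS.
    exact: continuous_measurable_fun.
  - apply/measurable_EFinP; apply: measurable_funTS.
    by apply: measurable_funM => //; exact: measurable_exponential_pdf.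
  - move=> x x0; rewrite -EFinM lee_fin exponential_pdfE// /h ger0_norm//.
    by rewrite mulrA mulVf ?gt_eqF// mul1r mulNr.
apply: (@le_lt_trans _ _ (\int[lebesgue_measure]_x
    (c^-1%:E * (exponential_pdf c x)%:E)))%E.
  apply: ge0_subset_integral => //.
  - apply/measurable_EFinP.
    by apply: measurable_funM => //; exact: measurable_exponential_pdf.
  - move=> x _; rewrite mule_ge0// lee_fin ?invr_ge0 ?exponential_pdf_ge0 ?ltW//.
rewrite ge0_integralZl_EFin//.
- by rewrite integral_exponential_pdf// mule1 ltry.
- by move=> x _; rewrite lee_fin exponential_pdf_ge0// ltW.
- by apply/measurable_EFinP; exact: measurable_exponential_pdf.
- by rewrite invr_ge0 ltW.
Qed.

(** * The kernel: symmetry, continuity and exponential decay *)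

Definition rate (R : realType) (beta B : R) : R := beta * ln B.

Lemma rate_gt0 (R : realType) (beta B : R) : 0 < beta -> 1 < B ->
  0 < rate beta B.
Proof. by move=> b0 B1; rewrite mulr_gt0 ?ln_gt0. Qed.

Lemma nuE (R : realType) (beta B p x : R) : 1 < B ->
  nu beta B p x = (1 + p * expR (- (rate beta B * x)))^-1.
Proof.
(* [powR] treats base 0 separately; [1 < B] selects the exponential branch. *)
move=> B1; rewrite /nu div1r /powR gt_eqF ?(lt_trans _ B1)//.
by rewrite /rate; congr ((1 + p * expR _)^-1); ring.
Qed.

Lemma nu_denom_gt0 (R : realType) (lam p x : R) : 0 < p ->
  0 < 1 + p * expR (- (lam * x)).
Proof. by move=> p0; rewrite ltr_wpDl// mulr_gt0 ?expR_gt0. Qed.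

Lemma nuN (R : realType) (beta B p x : R) : 1 < B -> 0 < p ->
  nu beta B p (- x) = 1 - nu beta B p^-1 x.
Proof.
move=> B1 p0; rewrite !nuE// mulrN opprK.
have p'0 : 0 < p^-1 by rewrite invr_gt0.
have := nu_denom_gt0 (rate beta B) x p'0.
rewrite expRN; have := expR_gt0 (rate beta B * x).
move: (expR _) => e e0 h.
have h' : 0 < 1 + p * e by rewrite ltr_wpDl// mulr_gt0.
by field; rewrite !gt_eqF// addr_gt0// mulr_gt0.
Qed.

Lemma G_N (R : realType) (beta B p x : R) : 1 < B -> 0 < p ->
  G beta B p (- x) = G beta B p^-1 x.
Proof.
move=> B1 p0; rewrite /G.
have -> : - x + 1 = - (x - 1) by ring.
have -> : - x - 1 = - (x + 1) by ring.
by rewrite !nuN//; ring.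
Qed.

Lemma PsiN (R : realType) (q beta B x : R) : 1 < B -> 0 < q ->
  Psi q beta B (- x) = Psi q beta B x.
Proof.
move=> B1 q0; rewrite /Psi (div1r q) !G_N ?invr_gt0// invrK.
by rewrite [in LHS]addrC.
Qed.

Lemma continuous_nu_denom (R : realType) (lam p : R) :
  continuous (fun x : R => 1 + p * expR (- (lam * x))).
Proof.
move=> x; apply: cvgD; first exact: cvg_cst.
apply: cvgMr; apply: continuous_cvg; first exact: continuous_expR.
by apply: cvgN; apply: cvgMr; exact: cvg_id.
Qed.

Lemma continuous_nu (R : realType) (beta B p : R) : 1 < B -> 0 < p ->
  continuous (nu beta B p).
Proof.
move=> B1 p0; rewrite (_ : nu _ _ _ =
    fun x => (1 + p * expR (- (rate beta B * x)))^-1); last first.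
  by apply/funext => x; exact: nuE.
move=> x; apply: cvgV; last exact: continuous_nu_denom.
by rewrite gt_eqF// nu_denom_gt0.
Qed.

Lemma continuous_G (R : realType) (beta B p : R) : 1 < B -> 0 < p ->
  continuous (G beta B p).
Proof.
move=> B1 p0 x; apply: cvgMr; apply: cvgB; apply: continuous_cvg;
  try exact: continuous_nu.
- by apply: cvgD; [exact: cvg_id|exact: cvg_cst].
- by apply: cvgB; [exact: cvg_id|exact: cvg_cst].
Qed.

Lemma continuous_Psi (R : realType) (q beta B : R) : 1 < B -> 0 < q ->
  continuous (Psi q beta B).
Proof.
move=> B1 q0 x; apply: cvgMr; apply: cvgD; apply: continuous_G => //.
by rewrite div1r invr_gt0.
Qed.

(** With [a <= b] the values of [p * expR (- (lam * _))] at [x + 1] and [x - 1], [G] is half of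
    [(1 + a)^-1 - (1 + b)^-1], which lies between 0 and [1 - (1 + b)^-1 <= b]. The upper bound
    decays only as x tends to +oo. *)
Lemma G_bounds (R : realType) (beta B p x : R) : 0 < beta -> 1 < B -> 0 < p ->
  0 <= G beta B p x <= p * (expR (rate beta B) * expR (- (rate beta B * x))).
Proof.
move=> b0 B1 p0; have lam0 := rate_gt0 b0 B1.
rewrite /G !nuE//; set lam := rate beta B in lam0 *.
have ab : p * expR (- (lam * (x + 1))) <= p * expR (- (lam * (x - 1))).
  by rewrite ler_pM2l// ler_expR lerN2 ler_pM2l//; lra.
have a0 : 0 < p * expR (- (lam * (x + 1))) by rewrite mulr_gt0 ?expR_gt0.
have -> : expR lam * expR (- (lam * x)) = expR (- (lam * (x - 1))).
  by rewrite -expRD; congr expR; ring.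
move: (p * expR (- (lam * (x + 1)))) (p * expR (- (lam * (x - 1)))) ab a0.
move=> a b ab a0.
have le_inv : (1 + b)^-1 <= (1 + a)^-1 by rewrite lef_pV2 ?posrE//; lra.
have diff : (1 + a)^-1 - (1 + b)^-1 <= b.
  have b_ge0 : 0 < b by lra.
  have : 1 - b <= (1 + b)^-1.
    rewrite -[leRHS]mul1r ler_pdivlMr//; nra.
  have : (1 + a)^-1 <= 1 by rewrite invf_le1//; lra.
  lra.
have b_gt0 : 0 < b by lra.
by apply/andP; split; lra.
Qed.

Lemma Psi_ge0 (R : realType) (q beta B x : R) : 0 < beta -> 1 < B -> 0 < q ->
  0 <= Psi q beta B x.
Proof.
move=> b0 B1 q0; have q'0 : 0 < 1 / q by rewrite div1r invr_gt0.
have /andP[h _] := G_bounds x b0 B1 q0; have /andP[h' _] := G_bounds x b0 B1 q'0.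
by rewrite /Psi; lra.
Qed.

Lemma Psi_le_expR (R : realType) (q beta B x : R) :
    0 < beta -> 1 < B -> 0 < q ->
  Psi q beta B x <=
    (q + q^-1) * (expR (rate beta B) * expR (- (rate beta B * `|x|))).
Proof.
move=> b0 B1 q0; have q'0 : 0 < 1 / q by rewrite div1r invr_gt0.
(* Evenness reduces to the side on which the bounds on [G] decay. *)
wlog x0 : x / 0 <= x.
  move=> h; have [/h//|/ltW x0] := leP 0 x.
  by rewrite -(PsiN _ _ B1 q0) -normrN h// oppr_ge0.
rewrite ger0_norm//.
have /andP[_ h] := G_bounds x b0 B1 q0; have /andP[_ h'] := G_bounds x b0 B1 q'0.
have : 0 <= Psi q beta B x by exact: Psi_ge0.
by rewrite /Psi (div1r q) mulrDl in h' *; lra.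
Qed.

(** * Total mass of the kernel *)

(* Up to the factor [lam] and a shift by [c], a primitive of [nu - 1] that
   vanishes at +oo. *)
Definition ln_nu_denom (R : realType) (lam p c x : R) : R :=
  ln (1 + p * expR (- (lam * (x + c)))).

Lemma is_derive_ln_nu_denom (R : realType) (beta B p x c : R) :
    1 < B -> 0 < p ->
  is_derive x (1 : R) (ln_nu_denom (rate beta B) p c)
    (rate beta B * (nu beta B p (x + c) - 1)).
Proof.
move=> B1 p0; set lam := rate beta B.
have hlin : is_derive x (1 : R) (fun y : R => - (lam * (y + c))) (- (lam *: (1 + 0))).
  apply: is_deriveN; apply: is_deriveZ; exact: is_deriveD.
have hexp : is_derive x (1 : R) (expR \o (fun y : R => - (lam * (y + c))))
    (expR (- (lam * (x + c))) * - (lam *: (1 + 0))).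
  exact: is_derive1_comp.
have hden : is_derive x (1 : R)
    (fun y : R => 1 + p * expR (- (lam * (y + c))))
    (0 + p *: (expR (- (lam * (x + c))) * - (lam *: (1 + 0)))).
  by apply: is_deriveD; exact: is_deriveZ.
have d0 := nu_denom_gt0 lam (x + c) p0.
have hln : is_derive (1 + p * expR (- (lam * (x + c)))) (1 : R) (@ln R)
    (1 + p * expR (- (lam * (x + c))))^-1 by exact: is_derive1_ln.
have := @is_derive1_comp R (@ln R) (fun y => 1 + p * expR (- (lam * (y + c)))) _ _ _
  hln hden.
move=> /is_derive_eq; apply; rewrite nuE// -/lam.
rewrite /GRing.scale /=; field.
by rewrite gt_eqF.
Qed.

Lemma cvg_ln_nu_denom (R : realType) (lam p c : R) : 0 < lam ->
  ln_nu_denom lam p c x @[x --> +oo] --> (0 : R).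
Proof.
move=> lam0.
have hden : (1 + p * expR (- (lam * (x + c)))) @[x --> +oo] --> (1 : R).
  rewrite -[X in _ --> X]addr0; apply: cvgD; first exact: cvg_cst.
  rewrite -(mulr0 p); apply: cvgMr.
  apply: (@cvg_comp _ _ _ (fun x => lam * (x + c)) (fun z => expR (- z))).
    apply: gt0_cvgMry => //; apply/cvgryPge => M; near=> x.
    by rewrite -lerBlDr; near: x; apply: nbhs_pinfty_ge; rewrite num_real.
  exact: cvgr_expR.
rewrite -(ln1 R); apply: continuous_cvg => //.
by apply: continuous_ln.
Unshelve. all: by end_near. Qed.

(** Factoring [p * expR lam] out of [1 + p * expR lam] leaves the denominator for [p^-1]. This
    evaluates the primitive of [Psi] at 0. *)
Lemma ln_nu_denom_reflect (R : realType) (lam p : R) : 0 < p ->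
  ln_nu_denom lam p (- 1) 0 - ln_nu_denom lam p^-1 1 0 = ln p + lam.
Proof.
move=> p0; have p'0 : 0 < p^-1 by rewrite invr_gt0.
rewrite /ln_nu_denom !add0r mulr1 mulrN1 opprK.
have d0 : 0 < 1 + p^-1 * expR (- lam) by rewrite ltr_wpDl// mulr_gt0 ?expR_gt0.
have -> : 1 + p * expR lam = p * expR lam * (1 + p^-1 * expR (- lam)).
  by rewrite expRN; field; rewrite !gt_eqF// expR_gt0.
rewrite !lnM ?posrE ?mulr_gt0 ?expR_gt0// expRK; ring.
Qed.

Lemma integral_Psi (R : realType) (q beta B : R) :
    0 < beta -> 1 < B -> 0 < q ->
  (\int[lebesgue_measure]_x (Psi q beta B x)%:E = 1)%E.
Proof.
move=> b0 B1 q0; have q'0 : 0 < q^-1 by rewrite invr_gt0.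
have lam0 := rate_gt0 b0 B1; set lam := rate beta B in lam0.
have cP : continuous (Psi q beta B) by exact: continuous_Psi.
(* A primitive of [Psi]: the 4 collects the factors 1/2 in [G] and in [Psi], [lam] comes from
   differentiating [ln_nu_denom], and the constants -1 cancel in the differences. *)
pose F x := (4 * lam)^-1 * ((ln_nu_denom lam q 1 x - ln_nu_denom lam q (- 1) x) +
  (ln_nu_denom lam q^-1 1 x - ln_nu_denom lam q^-1 (- 1) x)).
have dF x : is_derive x (1 : R) F (Psi q beta B x).
  have h := @is_derive_ln_nu_denom R beta B.
  have := is_deriveZ (4 * lam)^-1 (is_deriveD
    (is_deriveB (h q x 1 B1 q0) (h q x (- 1) B1 q0))
    (is_deriveB (h q^-1 x 1 B1 q'0) (h q^-1 x (- 1) B1 q'0))).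
  move=> /is_derive_eq; apply; rewrite /GRing.scale /= -/lam /Psi /G (div1r q).
  by field; rewrite gt_eqF.
have derF x : derivable F x 1 by case: (dF x).
rewrite ge0_symfun_integralT//; last 2 first.
- by move=> x; exact: Psi_ge0.
- by move=> x; rewrite /= PsiN.
rewrite -set_itvcy (@ge0_continuous_FTC2y R (Psi q beta B) F 0 0).
(* Adding the reflections for [q] and [q^-1] cancels the terms [ln q] and leaves [2 * lam], so half
   of the total mass is [- F 0 = 1/2]. *)
- have := ln_nu_denom_reflect lam q0; have := ln_nu_denom_reflect lam q'0.
  rewrite invrK lnV ?posrE// => h h'.
  have -> : F 0 = - 2^-1.
    rewrite /F; rewrite (_ : _ + _ = - (2 * lam)); last by lra.
    by field; rewrite gt_eqF.
  by rewrite sub0e -EFinN opprK -EFinM mulfV.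
- by move=> x _; exact: Psi_ge0.
- exact: continuous_subspaceT.
- rewrite -[X in _ --> X](mulr0 (4 * lam)^-1); apply: cvgMr.
  have -> : 0 = (0 - 0) + (0 - 0) :> R by lra.
  by apply: cvgD; apply: cvgB; exact: cvg_ln_nu_denom.
- by move=> x _; exact: derF.
- apply: cvg_at_right_filter.
  exact/differentiable_continuous/derivable1_diffP/derF.
- by move=> x _; rewrite derive1E; case: (dF x).
Qed.

(** * The operator as an average of translates, and convergence of its integrals *)

(** Moves [x] from the kernel into [f], so that values at different points become integrals against
    one common weight. *)
Lemma AE (R : realType) (q beta B : R) (n : nat) (f : R -> R) (x : R) :
    0 < beta -> 1 < B -> 0 < q -> continuous f ->
  A q beta B n f x =
  \int[lebesgue_measure]_u (f ((u + n%:R * x) / n%:R) * Psi q beta B u).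
Proof.
move=> b0 B1 q0 cf; rewrite /A (Rintegral_shift (n%:R * x)).
  apply: eq_Rintegral => u _; rewrite -PsiN//; congr (_ * Psi _ _ _ _); ring.
move=> v; apply: cvgM; apply: continuous_cvg.
- exact: cf.
- by apply: cvgMl; exact: cvg_id.
- exact: continuous_Psi.
- by apply: cvgB; [exact: cvg_cst|exact: cvg_id].
Qed.

Lemma integrable_mul_Psi (R : realType) (q beta B a b : R) (g : R -> R) :
    0 < beta -> 1 < B -> 0 < q ->
    continuous g -> (forall u, `|g u| <= a + b * `|u|) -> 0 <= a -> 0 <= b ->
  lebesgue_measure.-integrable setT (EFin \o (fun u => g u * Psi q beta B u)).
Proof.
move=> b0 B1 q0 cg gle a0 bge0; have lam0 := rate_gt0 b0 B1.
set lam := rate beta B in lam0.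
(* [K] is the constant of [Psi_le_expR]; in [C], [2 / lam] bounds [|u|] times an exponential of rate
   [lam / 2]. *)
pose K := (q + q^-1) * expR lam; pose C := K * (a + b * (2 / lam)).
have K0 : 0 <= K by rewrite mulr_ge0 ?expR_ge0// addr_ge0 ?invr_ge0 ?ltW.
apply: (@le_integrable _ _ R lebesgue_measure setT measurableT _
    (EFin \o (fun u : R => C * expR (- (lam / 2 * `|u|))))).
- apply/measurable_EFinP; apply: continuous_measurable_fun => u.
  by apply: cvgM; [exact: cg|exact: continuous_Psi].
- move=> u _; rewrite !abse_EFin lee_fin normrM.
  rewrite (ger0_norm (Psi_ge0 u b0 B1 q0)).
  apply: le_trans (ler_norm _).
  apply: (@le_trans _ _ ((a + b * `|u|) * (K * expR (- (lam * `|u|))))).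
    apply: ler_pM => //; first exact: Psi_ge0.
    by rewrite /K -mulrA; exact: Psi_le_expR.
  have -> : expR (- (lam * `|u|)) =
      expR (- (lam / 2 * `|u|)) * expR (- (lam / 2 * `|u|)).
    by rewrite -expRD; congr expR; field.
  have e0 := expR_gt0 (- (lam / 2 * `|u|)).
  rewrite /C /=; set e := expR (- (lam / 2 * `|u|)) in e0 *.
  rewrite [leLHS](_ : _ = K * ((a + b * `|u|) * e) * e); last by ring.
  rewrite ler_wpM2r ?(ltW e0)// ler_wpM2l//.
  have t0 : 0 <= lam / 2 * `|u| by rewrite mulr_ge0// divr_ge0// ltW.
  have e1 : e <= 1 by rewrite /e -[leRHS]expR0 ler_expR oppr_le0.
  (* [t * expR (- t) <= 1] at [t = lam / 2 * `|u|] absorbs the linear factor,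
     half of the decay rate being left for integrability. *)
  have te : lam / 2 * `|u| * e <= 1.
    rewrite /e expRN ler_pdivrMr ?expR_gt0// mul1r.
    by apply: le_trans (expR_ge1Dx _); lra.
  rewrite mulrDl; apply: lerD; first by rewrite ler_piMr//.
  rewrite -mulrA ler_wpM2l//.
  rewrite [leLHS](_ : _ = 2 / lam * (lam / 2 * `|u| * e)).
    by rewrite ler_piMr// divr_ge0// ltW.
  by field; rewrite gt_eqF.
- apply: (@eq_integrable _ _ R lebesgue_measure setT measurableT
    (fun u : R => C%:E * (EFin \o (fun v : R => expR (- (lam / 2 * `|v|)))) u)%E).
    by move=> u _ /=; rewrite EFinM.
  by apply: integrableZl => //; apply: integrable_expR_normr; rewrite divr_gt0.
Qed.

(** * Linear growth of the admissible functions *)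

(** If increments shorter than [d] change [f] by less than 1, a point closer to 0 than [k.+1] times
    [d] is reached from 0 in [k.+1] such increments. *)
Lemma unif_continuous_linear_growth (R : realType) (f : R -> R) :
  unif_continuous f ->
  exists2 b, 0 <= b & forall x, `|f x - f 0| <= 1 + b * `|x|.
Proof.
move=> /unif_continuousP/(_ 1 ltr01)[d d0 fd].
exists d^-1; first by rewrite invr_ge0 ltW.
have step (k : nat) x : `|x| < k.+1%:R * d -> `|f x - f 0| <= k.+1%:R.
  elim: k x => [x xd|k ih x xd].
    have := fd (x, 0); rewrite /ball/= subr0 => /(_ _)/ltW; apply.
    by rewrite mul1r in xd.
  (* The last point before [x] when the segment from 0 to [x] is cut into [k.+2] equal pieces. *)
  pose y := (k.+1%:R / k.+2%:R) * x.
  have -> : f x - f 0 = (f x - f y) + (f y - f 0) by ring.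
  rewrite [leRHS]mulrS; apply: (le_trans (ler_normD _ _)); apply: lerD.
    have := fd (x, y); rewrite /ball/= => /(_ _)/ltW; apply.
    have -> : x - y = x / k.+2%:R by rewrite /y -[in k.+1%:R]natr1 mulrS; field.
    by rewrite normrM normfV normr_nat ltr_pdivrMr// mulrC.
  apply: ih; rewrite !normrM normfV !normr_nat mulrAC ltr_pdivrMr//.
  by rewrite -mulrA ltr_pM2l// mulrC.
move=> x; have xd0 : 0 <= `|x| / d by rewrite divr_ge0// ltW.
(* The number of increments is one more than the integer part of [|x| / d]. *)
apply: le_trans (step (Num.truncn (`|x| / d)) x _) _.
  by rewrite -ltr_pdivrMr// truncnS_gt.
by rewrite mulrS lerD2l (mulrC d^-1) truncn_le.
Qed.

Lemma C_BU_growth (R : realType) (f : R -> R) : (C_B R `|` C_U R) f ->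
  continuous f /\
  exists a b, [/\ 0 <= a, 0 <= b & forall x, `|f x| <= a + b * `|x|].
Proof.
case=> [[cf [M [_ fM]]]|uf].
(* Boundedness provides a bound by each constant strictly above [M]; this one is also
   nonnegative. *)
- split=> //; exists (`|M| + 1), 0; split=> // x.
  by rewrite mul0r addr0; apply: fM => //; rewrite (le_lt_trans (ler_norm _))// ltrDl.
- split.
    move=> x; apply/cvgrPdist_lt => e e0.
    have [d d0 fd] := (unif_continuousP f).1 uf e e0.
    by apply: filterS (nbhsx_ballx x d d0) => y xy; exact: (fd (x, y)).
  have [b b0 fb] := unif_continuous_linear_growth uf.
  exists (`|f 0| + 1), b; split=> // x.
  have -> : f x = f 0 + (f x - f 0) by ring.
  by rewrite -addrA; apply: (le_trans (ler_normD _ _)); rewrite lerD2l.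
Qed.

(** * Contraction of oscillations and the modulus of continuity *)

(** The translates of [f] at [x] and [y] are evaluated at arguments differing by exactly [x - y], so
    their difference is at most [w] pointwise, and averaging keeps this bound. A real [w] in place
    of [omega] lets the estimate serve both claims of the theorem. *)
Lemma A_contract (R : realType) (q beta B : R) (n : nat) (f : R -> R)
    (theta w x y : R) :
    0 < beta -> 1 < B -> 0 < q -> (0 < n)%N -> (C_B R `|` C_U R) f ->
    (forall s t, `|s - t| <= theta -> `|f s - f t| <= w) ->
    `|x - y| <= theta ->
  `|A q beta B n f x - A q beta B n f y| <= w.
Proof.
move=> b0 B1 q0 n0 /C_BU_growth[cf [a [b [a0 bge0 fab]]]] fw xy.
have n_gt0 : 0 < n%:R :> R by rewrite ltr0n.
have cshift (z : R) : continuous (fun u : R => f ((u + n%:R * z) / n%:R)).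
  move=> u; apply: (@continuous_comp _ _ _ (fun u => (u + n%:R * z) / n%:R)).
    by apply: cvgMl; apply: cvgD; [exact: cvg_id|exact: cvg_cst].
  exact: cf.
have intf (z : R) : lebesgue_measure.-integrable setT
    (EFin \o (fun u : R => f ((u + n%:R * z) / n%:R) * Psi q beta B u)).
  (* The argument of [f] is [z + u / n], so [|z|] enters the constant term and [1 / n] the slope. *)
  apply: (@integrable_mul_Psi _ _ _ _ (a + b * `|z|) (b / n%:R)) => //.
  - move=> u; apply: le_trans (fab _) _.
    rewrite -addrA lerD2l -mulrA -mulrDr ler_wpM2l//.
    have -> : (u + n%:R * z) / n%:R = z + n%:R^-1 * u by field; rewrite gt_eqF.
    apply: le_trans (ler_normD _ _) _.
    by rewrite normrM normfV (ger0_norm (ltW n_gt0)).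
  - by rewrite addr_ge0// mulr_ge0.
  - by rewrite divr_ge0// ltW.
have intP (k : R) : lebesgue_measure.-integrable setT
    (EFin \o (fun u : R => k * Psi q beta B u)).
  apply: (@integrable_mul_Psi _ _ _ _ `|k| 0 (cst k)) => //.
  - by move=> u; exact: cvg_cst.
  - by move=> u; rewrite mul0r addr0.
rewrite !AE// -RintegralB//.
have intfB := integrableB measurableT (intf x) (intf y).
apply: le_trans (le_normr_Rintegral _ _) _ => //.
(* The kernel has mass 1, so the claim becomes a pointwise comparison of integrands. *)
have -> : w = \int[lebesgue_measure]_u (w * Psi q beta B u).
  rewrite RintegralZl//; first by rewrite /Rintegral integral_Psi// mulr1.
  by apply: eq_integrable (intP 1) => // u _ /=; rewrite mul1r.
apply: le_Rintegral => //; first exact: integrable_norm intfB.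
move=> u _; rewrite -mulrBl normrM (ger0_norm (Psi_ge0 u b0 B1 q0)).
rewrite ler_wpM2r ?Psi_ge0//; apply: fw.
rewrite [X in `|X|](_ : _ = x - y)//.
by field; rewrite gt_eqF.
Qed.

Theorem theorem5 (R : realType) (q beta B : R)
    (q_gt0 : 0 < q) (beta_gt0 : 0 < beta) (B_gt1 : 1 < B)
    (n : nat) (n_gt0 : (0 < n)%N)
    (f : R -> R) (f_CBU : (C_B R `|` C_U R) f) :
  (forall theta : R, 0 < theta ->
     (omega (A q beta B n f) theta <= omega f theta)%E) /\
  (C_U R f -> C_U R (A q beta B n f)).
Proof.
split.
- move=> theta theta0; apply: ge_ereal_sup => _ [[x y]/= xy <-].
  have ub s t : `|s - t| <= theta -> (`|f s - f t|%:E <= omega f theta)%E.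
    by move=> st; apply: ereal_sup_ubound; exists (s, t).
  (* An infinite modulus makes the claim trivial, and -oo is excluded by the pair [(x, y)]
     itself. *)
  case omegaE : (omega f theta) ub => [w| |] ub; last 2 first.
  + exact: leey.
  + by have := ub x y xy; rewrite leeNy_eq.
  + by rewrite lee_fin; apply: (@A_contract _ _ _ _ _ _ theta).
- move=> /unif_continuousP uf; apply/unif_continuousP => e e0.
  (* Halving [e] and [d] passes between the nonstrict inequalities of [A_contract] and the strict
     ones of uniform continuity. *)
  have [d d0 fd] := uf (e / 2) (divr_gt0 e0 (ltr0Sn _ 1)).
  exists (d / 2); first by rewrite divr_gt0.
  move=> [x y]; rewrite /ball/= => xy.
  apply: (@le_lt_trans _ _ (e / 2)); last by lra.
  apply: (@A_contract _ _ _ _ _ _ (d / 2)) => //; last exact: ltW.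
  move=> s t st; apply: ltW; apply: (fd (s, t)); rewrite /ball/=; lra.
Qed.
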